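(* Let $\mathfrak{h}\in\mathbb{H}_d$ be a doubling dimension function such that, for some $0<\alpha<1$, $\mathfrak{h}(x)\lesssim x^\alpha$ (i.e. there is a constant $C>0$ with $\mathfrak{h}(x)\le C x^\alpha$ for all $x$), and let $E\subseteq\mathbb{R}^2$ be an $F_{\mathfrak{h}}$-set. Let $h\in\mathbb{H}$ with $h\prec\mathfrak{h}$. If $$\sum_k \left(\frac{\mathfrak{h}(2^{-k})}{h(2^{-k})}\right)^{\frac{2\alpha}{2\alpha+1}}<\infty,$$ where the sum runs over $k\in\mathbb{N}$, then $\mathcal{H}^{h\sqrt{\cdot}}(E)>0$.
   Context: Dimension functions: $\mathbb{H}$ is the set of functions $h:[0,\infty)\to[0,\infty)$ that are non-decreasing, right continuous, and satisfy $h(0)=0$. The subclass $\mathbb{H}_d\subseteq\mathbb{H}$ consists of those $h\in\mathbb{H}$ for which there is a constant $C>0$ with $h(2x)\le C\,h(x)$ for all $x$. Hausdorff measures: for $h\in\mathbb{H}$, $E\subseteq\mathbb{R}^2$ and $\delta>0$, $\mathcal{H}^h_\delta(E)=\inf\{\sum_i h(\operatorname{diam}(E_i)) : E\subseteq\bigcup_{i=1}^\infty E_i,\ \operatorname{diam}(E_i)<\delta\}$, and $\mathcal{H}^h(E)=\sup_{\delta>0}\mathcal{H}^h_\delta(E)$ (an outer measure). Order: for dimension functions $g,h$, $g\prec h$ means $\lim_{x\to0^+} h(x)/g(x)=0$ (in particular $g(x)>0$ for $x>0$). $h\sqrt{\cdot}$ denotes the dimension function $x\mapsto h(x)\sqrt{x}$.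 Furstenberg sets: for $\mathfrak{h}\in\mathbb{H}$, a set $E\subseteq\mathbb{R}^2$ is an $F_{\mathfrak{h}}$-set (Furstenberg set of type $\mathfrak{h}$) if for each direction $e$ in the unit circle $\mathbb{S}$ there is a line segment $\ell_e$ in the direction of $e$ such that $\mathcal{H}^{\mathfrak{h}}(\ell_e\cap E)>0$. *)

(* Defs.v *)
(* MathComp-Analysis. *)
From HB Require Import structures.
From mathcomp Require Import all_boot all_order all_algebra.
From mathcomp Require Import all_classical all_reals all_analysis.

Set Implicit Arguments.
Unset Strict Implicit.
Unset Printing Implicit Defensive.

Import Order.TTheory GRing.Theory Num.Theory.
Import numFieldNormedType.Exports.

Local Open Scope classical_set_scope.
Local Open Scope ring_scope.

(* Functions [0, oo) -> [0, oo) are represented by functions R -> R that are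
   only ever constrained and evaluated on nonnegative arguments. *)
Record dimension_function (R : realType) (h : R -> R) : Prop := {
  dimension_function_ge0 : forall x, 0 <= x -> 0 <= h x ;
  dimension_function_nd : forall x y, 0 <= x -> x <= y -> h x <= h y ;
  dimension_function_rc : forall x, 0 <= x -> h y @[y --> x^'+] --> h x ;
  dimension_function0 : h 0 = 0 }.

Definition doubling_dimension_function (R : realType) (h : R -> R) : Prop :=
  dimension_function h /\
  exists2 C : R, 0 < C & forall x, 0 <= x -> h (2 * x) <= C * h x.

(* Positivity of g is required separately because y / 0 = 0 here. *)
Definition prec (R : realType) (g h : R -> R) : Prop :=
  (forall x, 0 < x -> 0 < g x) /\ h x / g x @[x --> 0^'+] --> 0.

Definition mul_sqrt (R : realType) (h : R -> R) : R -> R :=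
  fun x => h x * Num.sqrt x.

(* The library norm on R * R is the sup norm, hence the explicit Euclidean
   norm. *)
Definition enorm (R : realType) (p : R * R) : R :=
  Num.sqrt (p.1 ^+ 2 + p.2 ^+ 2).

(* The maximum with 0 only matters for A = set0, whose diameter is 0
   (the supremum of the empty set is -oo). *)
Definition ediam (R : realType) (A : set (R * R)) : \bar R :=
  maxe 0%E (ereal_sup [set (enorm (p - q))%:E | p in A & q in A]).

Definition hausdorff_content (R : realType) (h : R -> R) (delta : R)
    (E : set (R * R)) : \bar R :=
  ereal_inf [set (\sum_(i <oo) (h (fine (ediam (A i))))%:E)%E |
    A in [set A : nat -> set (R * R) |
      E `<=` \bigcup_i A i /\ forall i, (ediam (A i) < delta%:E)%E]].

Definition hausdorff_measure (R : realType) (h : R -> R) (E : set (R * R)) :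
    \bar R :=
  ereal_sup [set hausdorff_content h delta E | delta in [set d : R | 0 < d]].

(* The closed segment with endpoints a and a + len * e. *)
Definition segment (R : realType) (a e : R * R) (len : R) : set (R * R) :=
  [set (a.1 + t * e.1, a.2 + t * e.2) | t in `[0, len]].

Definition furstenberg_set (R : realType) (h : R -> R) (E : set (R * R)) :
    Prop :=
  forall e : R * R, enorm e = 1 ->
    exists (a : R * R) (len : R),
      0 < len /\ (0 < hausdorff_measure h (segment a e len `&` E))%E.

(* Main.v *)
Require Import Defs.
From HB Require Import structures.
From mathcomp Require Import all_boot all_order all_algebra finmap.
From mathcomp Require Import all_classical all_reals all_analysis.
From mathcomp Require Import ring lra.

Import Order.TTheory GRing.Theory Num.Theory.
Import numFieldNormedType.Exports.

Local Open Scope classical_set_scope.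
Local Open Scope ring_scope.

Set Implicit Arguments.
Unset Strict Implicit.
Unset Printing Implicit Defensive.

(** Write F for the given doubling function and let
    a_k = (F(2^-k) / h(2^-k))^(2 alpha / (2 alpha + 1)), a summable sequence
    with sum at most A0. Directions are parametrised by their slope t in [0, 1[,
    and each carries a segment l_t on which E has positive F-measure.

    Suppose that E is null for h sqrt. Then E has covers by sets A_i of diameter
    d_i < 1 whose cost, the sum of the h(d_i) sqrt(d_i), is as small as desired.
    Fix c, delta > 0 and let S be the set of slopes t for which E meets l_t in
    F-content (at scale delta) more than c. Sort the A_i by generation: the k-th
    one has diameters in [2^-k, 2^(1-k)[. Content is countably subadditive and
    the a_k / A0 add up to at most 1, so every t in S lies in some T_k, the set of
    slopes for which generation k alone captures content more than c a_k / A0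
    of E on l_t.

    The heart of the matter is a bound on T_k by the cost of generation k
    ([slopes_measure_le_esum]). A piece of l_t of length r has content at most
    F(r) <~ r^alpha, so with r ~ a_k^(1/alpha) the content captured on l_t
    survives the removal of such a piece: it splits into two comparable parts
    at distance at least r ([split_segment]), each of which meets at least
    ~ a_k / F(2^-k) of the N sets of generation k. Two sets of size 2^-k hit at
    distance r determine the slope up to ~ 2^-k / r ([slope_dist]). If T_k meets
    M dyadic intervals of length 2^-k, counting triples (interval, set, set) in
    two ways ([count_directions]) gives M (a_k / F(2^-k))^2 <~ N^2 / r, hence
      M 2^-k <= (M 2^-k)^(1/2) <~ N 2^(-k/2) F(2^-k) / a_k^(1 + 1/(2 alpha)),
    and the exponent in a_k is the one which turns the right-hand side into
    N h(2^-k) 2^(-k/2) ([scale_constant]), a lower bound for the cost of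
    generation k. The implied constant does not depend on k. Hence summing over
    k bounds the outer Lebesgue measure of S by the total cost, so S is null
    ([slopes_null]). Letting c = delta = 1/(n+1), countably many such sets S
    cover [0, 1[, which is absurd. *)

(** * Hausdorff content as an outer measure *)

Lemma ediam_ge0 (R : realType) (X : set (R * R)) : (0 <= ediam X)%E.
Proof. by rewrite /ediam le_max lexx. Qed.

Lemma enorm_le_ediam (R : realType) (X : set (R * R)) (p q : R * R) :
  X p -> X q -> ((enorm (p - q))%:E <= ediam X)%E.
Proof.
move=> Xp Xq; rewrite /ediam le_max; apply/orP; right.
by apply: ereal_sup_ubound; exists p => //; exists q.
Qed.

Lemma ediam_le (R : realType) (X : set (R * R)) (d : R) : 0 <= d ->
  (forall p q, X p -> X q -> enorm (p - q) <= d) -> (ediam X <= d%:E)%E.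
Proof.
move=> d0 Xd; rewrite /ediam ge_max lee_fin d0 /=.
by apply: ge_ereal_sup => _ [p Xp [q Xq <-]]; rewrite lee_fin Xd.
Qed.

Lemma ediam0 (R : realType) : ediam (@set0 (R * R)) = 0%E.
Proof. by apply/eqP; rewrite eq_le ediam_ge0 andbT; apply: ediam_le. Qed.

(** Giving infinite weight to the sets that are too large removes the size
    constraint from the covers, so that the content becomes an instance of the
    general outer measure construction [mu_ext]. *)
Definition gauge (R : realType) (h : R -> R) (delta : R) (X : set (R * R)) :
    \bar R :=
  if (ediam X < delta%:E)%E then (h (fine (ediam X)))%:E else +oo%E.

Section Content.
Variables (R : realType) (h : R -> R).
Hypothesis hdim : dimension_function h.

Lemma gauge_ge0 delta X : (0 <= gauge h delta X)%E.
Proof.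
rewrite /gauge; case: ifP => // _; rewrite lee_fin.
by apply: (dimension_function_ge0 hdim); rewrite fine_ge0 ?ediam_ge0.
Qed.

Lemma gauge0 delta : 0 < delta -> gauge h delta set0 = 0%E.
Proof.
by move=> d0; rewrite /gauge ediam0 lte_fin d0 /= (dimension_function0 hdim).
Qed.

(** Every subset must be allowed in the covers, whence the sigma-algebra
    generated by all subsets. A cover containing a set of infinite gauge has
    infinite cost and does not affect the infimum. *)
Lemma hausdorff_contentE delta (E : set (R * R)) :
  hausdorff_content h delta E =
  @mu_ext _ (g_sigma_algebraType (@setT (set (R * R)))) R (gauge h delta) E.
Proof.
apply/eqP; rewrite eq_le; apply/andP; split; apply: le_ereal_inf_tmp => x [A].
- move=> [_ EA] <- {x}.
  have [dA|/existsNP[i /negP dA]] := pselect (forall i, (ediam (A i) < delta%:E)%E).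
    rewrite (eq_eseriesr (g := fun i => (h (fine (ediam (A i))))%:E)).
      by apply: ereal_inf_lbound; exists A.
    by move=> i _; rewrite /gauge dA.
  rewrite (eseries_pinfty (k := i)) ?leey// ?/gauge ?(negbTE dA)//.
  by move=> n _; rewrite -ltNye (lt_le_trans _ (gauge_ge0 _ _)).
- move=> [EA dA] <- {x}.
  rewrite (eq_eseriesr (g := fun i => gauge h delta (A i))).
    apply: ereal_inf_lbound; exists A => //; split => // i.
    exact: sub_gen_smallest.
  by move=> i _; rewrite /gauge dA.
Qed.

(** From here on only the outer measure axioms and [hausdorff_content_le] are
    needed, hence the arguments below are stated for an abstract [mu]. *)
Lemma hausdorff_content_outer_measure delta : 0 < delta ->
  exists mu : {outer_measure set (R * R) -> \bar R},
    hausdorff_content h delta = mu :> (set (R * R) -> \bar R).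
Proof.
move=> d0.
pose T := g_sigma_algebraType (@setT (set (R * R))).
have cE : hausdorff_content h delta = @mu_ext _ T R (gauge h delta).
  by apply/funext => E; exact: hausdorff_contentE.
have g0 := gauge0 d0; have gge0 := gauge_ge0 delta.
have c0 : hausdorff_content h delta set0 = 0%E.
  by rewrite cE; exact: (@mu_ext0 _ T R _ g0 gge0).
have cge0 X : (0 <= hausdorff_content h delta X)%E.
  by rewrite cE; exact: (@mu_ext_ge0 _ T R _ gge0).
have cle : {homo hausdorff_content h delta : X Y / X `<=` Y >-> (X <= Y)%E}.
  by rewrite cE; exact: (@le_mu_ext _ T R).
have csub : sigma_subadditive (hausdorff_content h delta).
  by rewrite cE; exact: (@mu_ext_sigma_subadditive _ T R _ gge0).
pose m := isOuterMeasure.Build R (R * R)%type _ c0 cge0 cle csub.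
pose mu : {outer_measure set (R * R) -> \bar R} :=
  HB.pack (hausdorff_content h delta) m.
by exists mu.
Qed.

Lemma hausdorff_content_le delta d (X : set (R * R)) : 0 <= d -> d < delta ->
  (forall p q, X p -> X q -> enorm (p - q) <= d) ->
  (hausdorff_content h delta X <= (h d)%:E)%E.
Proof.
move=> d0 ddelta Xd.
have Xdiam := ediam_le d0 Xd.
have Xfin : ediam X \is a fin_num.
  by rewrite ge0_fin_numE ?ediam_ge0// (le_lt_trans Xdiam) ?ltry.
pose A i := if i is 0%N then X else set0.
apply: (@le_trans _ _ (\sum_(i <oo) (h (fine (ediam (A i))))%:E)%E).
  apply: ereal_inf_lbound; exists A => //; split; first by move=> x Xx; exists 0%N.
  case=> [|i]; first by rewrite (le_lt_trans Xdiam) ?lte_fin.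
  by rewrite ediam0 lte_fin (le_lt_trans d0).
rewrite nneseries_recl// ?[X in (_ + X)%E]eseries0 ?adde0.
- rewrite lee_fin; apply: (dimension_function_nd hdim); rewrite ?fine_ge0 ?ediam_ge0//.
  by rewrite -lee_fin fineK.
- by case=> [|i]// _ _; rewrite /= ediam0 (dimension_function0 hdim).
- by move=> i _; rewrite lee_fin (dimension_function_ge0 hdim)// fine_ge0 ?ediam_ge0.
Qed.

Lemma hausdorff_content_antitone delta1 delta2 (X : set (R * R)) :
  delta1 <= delta2 ->
  (hausdorff_content h delta2 X <= hausdorff_content h delta1 X)%E.
Proof.
move=> d12; apply: ereal_inf_le_tmp => _ [A [XA dA] <-].
exists A => //; split => // i; rewrite (lt_le_trans (dA i))//.
Qed.

End Content.

(** * Two separated portions of a segment *)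

Definition line_point (R : realType) (a e : R * R) (t : R) : R * R :=
  (a.1 + t * e.1, a.2 + t * e.2).

Lemma enorm_line_pointB (R : realType) (a e : R * R) (s t : R) :
  enorm e = 1 -> enorm (line_point a e s - line_point a e t) = `|s - t|.
Proof.
move=> e1; rewrite /enorm /line_point /=.
rewrite (_ : _ + _ = (s - t) ^+ 2 * (e.1 ^+ 2 + e.2 ^+ 2)); last by ring.
by rewrite sqrtrM ?sqr_ge0// sqrtr_sqr [Num.sqrt _]e1 mulr1.
Qed.

(** Cut the line into intervals of length [r]. The prefix just before the
    first one of content more than [c / 3] has content at most [c / 3]; the two
    intervals of length [r] after it contribute at most [c / 9] each, so what
    lies beyond them still has content at least [4 c / 9]. *)
Lemma split_segment (R : realType) (mu : {outer_measure set (R * R) -> \bar R})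
    (a e : R * R) (len : R) (G : set (R * R)) (c r : R) :
  enorm e = 1 -> 0 < c -> 0 < r ->
  (forall X : set (R * R),
    (forall p q, X p -> X q -> enorm (p - q) <= r) -> (mu X <= (c / 9)%:E)%E) ->
  (c%:E < mu (segment a e len `&` G))%E ->
  exists s,
    ((c / 3)%:E < mu (line_point a e @` `[0%R, s] `&` G))%E /\
    ((c / 3)%:E < mu (line_point a e @` `[(s + r)%R, len] `&` G))%E.
Proof.
move=> e1 c0 r0 small big.
pose part (I : interval R) := (line_point a e @` [set` I]) `&` G.
have part_small s : (mu (part `[s, (s + r)%R]) <= (c / 9)%:E)%E.
  apply: small => _ _ [[t /= tI <-] _] [[t' /= t'I <-] _].
  rewrite enorm_line_pointB// ler_norml.
  by move: tI t'I; rewrite !in_itv /= => /andP[? ?] /andP[? ?]; apply/andP; split; lra.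
have exm : exists m : nat, ((c / 3)%:E < mu (part `[0%R, (m%:R * r)%R]))%E.
  exists (Num.truncn (len / r)).+1.
  apply: (@lt_trans _ _ c%:E); first by rewrite lte_fin; lra.
  apply: (lt_le_trans big); apply: le_outer_measure.
  move=> p [[t /= tI <-] Gp]; split => //; exists t => //=.
  move: tI; rewrite !in_itv /= => /andP[-> tlen] /=.
  rewrite -ler_pdivrMr// ltW// (le_lt_trans _ (truncnS_gt _))//.
  by rewrite ler_pM2r ?invr_gt0.
case: (ex_minnP exm) => m mbig mmin; exists (m%:R * r); split => //.
rewrite ltNge; apply/negP => rest.
case: m mbig mmin rest => [|m] mbig mmin rest.
  have : (mu (part `[0%R, (0%:R * r)%R]) <= (c / 9)%:E)%E.
    apply: le_trans (part_small 0); apply: le_outer_measure.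
    apply: setSI; apply: image_subset => t /=; rewrite !in_itv /=.
    by move=> /andP[-> /le_trans] ->//; rewrite mul0r add0r ltW.
  by move=> /(lt_le_trans mbig); rewrite lte_fin; lra.
have pre : (mu (part `[0%R, (m%:R * r)%R]) <= (c / 3)%:E)%E.
  by rewrite leNgt; apply/negP => /mmin; rewrite ltnn.
have cover : segment a e len `&` G `<=`
    (part `[0%R, (m%:R * r)%R] `|` part `[m%:R * r, m%:R * r + r]) `|`
    (part `[m.+1%:R * r, m.+1%:R * r + r] `|` part `[m.+1%:R * r + r, len]).
  move=> _ [[t /= tI <-] Gp]; move: tI; rewrite in_itv /= => /andP[t0 tlen].
  have mS : m.+1%:R * r = m%:R * r + r by rewrite -natr1 mulrDl mul1r.
  have [t1|t1] := leP t (m%:R * r).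
    by left; left; split => //; exists t => //=; rewrite in_itv /= t0.
  have [t2|t2] := leP t (m%:R * r + r).
    by left; right; split => //; exists t => //=; rewrite in_itv /= ltW.
  have [t3|t3] := leP t (m.+1%:R * r + r).
    by right; left; split => //; exists t => //=; rewrite in_itv /= t3 mS ltW.
  by right; right; split => //; exists t => //=; rewrite in_itv /= tlen ltW.
have := lt_le_trans big (le_outer_measure mu _ _ cover).
apply/negP; rewrite -leNgt.
apply: (le_trans (outer_measureU2 _ _ _)).
apply: (le_trans (leeD (outer_measureU2 _ _ _) (outer_measureU2 _ _ _))).
apply: (le_trans (leeD (leeD pre (part_small _)) (leeD (part_small _) rest))).
by rewrite -!EFinD lee_fin; lra.
Qed.

(** * The slope of a line through two small sets *)

Definition slope_dir (R : realType) (t : R) : R * R :=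
  ((Num.sqrt (1 + t ^+ 2))^-1, t * (Num.sqrt (1 + t ^+ 2))^-1).

Lemma enorm_slope_dir (R : realType) (t : R) : enorm (slope_dir t) = 1.
Proof.
have t1 : 0 < 1 + t ^+ 2 by rewrite ltr_pwDl ?sqr_ge0.
rewrite /enorm /slope_dir /=.
rewrite (_ : _ + _ = (1 + t ^+ 2) * (Num.sqrt (1 + t ^+ 2)) ^- 2); last by rewrite -exprVn; ring.
by rewrite sqr_sqrtr ?ltW// mulfV ?gt_eqF// sqrtr1.
Qed.

Lemma abs_fst_le_enorm (R : realType) (p : R * R) : `|p.1| <= enorm p.
Proof. by rewrite -sqrtr_sqr ler_wsqrtr// lerDl sqr_ge0. Qed.

Lemma abs_snd_le_enorm (R : realType) (p : R * R) : `|p.2| <= enorm p.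
Proof. by rewrite -sqrtr_sqr ler_wsqrtr// lerDr sqr_ge0. Qed.

(** Slope is the quotient of the increments of the coordinates between two
    points of the line. For slopes in [0, 1] the first increment is at least
    [r / sqrt 2], and moving both points by at most [d] changes the increments by
    at most [2 d]. *)
Lemma slope_dist (R : realType) (t t' : R) (a a' : R * R) (s1 s2 s1' s2' d r : R) :
  0 <= t <= 1 -> 0 <= t' <= 1 -> 0 < r -> r <= s2 - s1 ->
  enorm (line_point a (slope_dir t) s1 - line_point a' (slope_dir t') s1') <= d ->
  enorm (line_point a (slope_dir t) s2 - line_point a' (slope_dir t') s2') <= d ->
  `|t - t'| <= 8 * d / r.
Proof.
move=> /andP[t0 t1] /andP[t'0 t'1] r0 rs d1 d2.
have := le_trans (abs_fst_le_enorm _) d1; have := le_trans (abs_fst_le_enorm _) d2.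
have := le_trans (abs_snd_le_enorm _) d1; have := le_trans (abs_snd_le_enorm _) d2.
rewrite /line_point /slope_dir /=; clear d1 d2.
set u := (Num.sqrt (1 + t ^+ 2))^-1; set u' := (Num.sqrt (1 + t' ^+ 2))^-1.
have u2 : 2^-1 <= u.
  rewrite lef_pV2 ?posrE ?sqrtr_gt0 ?ltr_pwDl ?sqr_ge0//.
  rewrite -[leRHS]ger0_norm// -sqrtr_sqr ler_wsqrtr//.
  nra.
rewrite !ler_norml => /andP[y2 y2'] /andP[y1 y1'] /andP[x2 x2'] /andP[x1 x1'].
rewrite -ler_norml ler_pdivlMr//.
have -> : `|t - t'| * r <= 8 * d; last by [].
have sr : r / 2 <= (s2 - s1) * u by rewrite ler_pM// ?ltW.
have key : `|(t - t') * ((s2 - s1) * u)| <= 4 * d.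
  (* The second increment minus t' times the first one, for the line of slope
     t; this quantity vanishes for the line of slope t'. *)
  have -> : (t - t') * ((s2 - s1) * u) =
    (a.2 + s2 * (t * u) - (a'.2 + s2' * (t' * u')))
    - (a.2 + s1 * (t * u) - (a'.2 + s1' * (t' * u')))
    - t' * ((a.1 + s2 * u - (a'.1 + s2' * u')) - (a.1 + s1 * u - (a'.1 + s1' * u'))).
    by ring.
  rewrite ler_norml; nra.
rewrite normrM [X in _ * X]ger0_norm in key; last by rewrite (le_trans _ sr)// divr_ge0// ltW.
have : `|t - t'| * (r / 2) <= 4 * d by rewrite (le_trans _ key)// ler_wpM2l.
lra.
Qed.

(** * Counting directions *)

(** Both sides estimate the number of triples (i, j, j') with [i] in [X], [j] in
    [P i] and [j'] in [Q i]. *)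
Lemma double_count (R : realFieldType) (I J : finType) (X : {set I})
    (P Q : I -> {set J}) (n b : R) : 0 <= n ->
  (forall i, i \in X -> n <= #|P i|%:R) ->
  (forall i, i \in X -> n <= #|Q i|%:R) ->
  (forall j j', #|[set i in X | (j \in P i) && (j' \in Q i)]|%:R <= b) ->
  #|X|%:R * n ^+ 2 <= #|J|%:R ^+ 2 * b.
Proof.
move=> n0 nP nQ PQb.
have -> : #|J|%:R ^+ 2 * b = \sum_(j in J) \sum_(j' in J) b.
  by rewrite !sumr_const -mulrnA -[RHS]mulr_natl natrM expr2.
apply: (@le_trans _ _
    (\sum_(j in J) \sum_(j' in J) #|[set i in X | (j \in P i) && (j' \in Q i)]|%:R)); last first.
  by apply: ler_sum => j _; apply: ler_sum => j' _.
have -> : (\sum_(j in J) \sum_(j' in J)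
      #|[set i in X | (j \in P i) && (j' \in Q i)]|%:R : R) =
    \sum_(i in X) #|P i|%:R * #|Q i|%:R.
  transitivity (\sum_(j in J) \sum_(j' in J) \sum_(i in X)
      (j \in P i)%:R * (j' \in Q i)%:R : R).
    apply: eq_bigr => j _; apply: eq_bigr => j' _.
    rewrite -sum1_card natr_sum big_mkcond [RHS]big_mkcond /=.
    by apply: eq_bigr => i _; rewrite inE -natrM mulnb; case: (i \in X) => //=; case: (_ && _).
  have cardE (S : {set J}) : #|S|%:R = \sum_(j in J) (j \in S)%:R :> R.
    by rewrite -sum1_card natr_sum big_mkcond; apply: eq_bigr => k _; case: (_ \in _).
  under eq_bigr do rewrite exchange_big.
  rewrite exchange_big; apply: eq_bigr => i _.
  rewrite !cardE big_distrl /=; apply: eq_bigr => j _.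
  by rewrite big_distrr.
have -> : #|X|%:R * n ^+ 2 = \sum_(i in X) n ^+ 2 by rewrite sumr_const mulr_natl.
apply: ler_sum => i iX; rewrite expr2 ler_pM ?nP ?nQ//.
Qed.

Lemma card_cluster (R : realFieldType) (n : nat) (X : {set 'I_n}) (b : R) :
  0 <= b -> (forall i i', i \in X -> i' \in X -> (i : nat)%:R - (i' : nat)%:R <= b) ->
  #|X|%:R <= b + 1.
Proof.
move=> b0 Xb; have [->|[i0 i0X]] := set_0Vmem X.
  by rewrite cards0 addr_ge0.
pose i1 := [arg min_(i < i0 in X) (i : nat)]%N.
have [i1X i1min] : i1 \in X /\ forall i, i \in X -> (i1 <= i)%N.
  by rewrite /i1; case: arg_minnP.
pose i2 := [arg max_(i > i0 in X) (i : nat)]%N.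
have [i2X i2max] : i2 \in X /\ forall i, i \in X -> (i <= i2)%N.
  by rewrite /i2; case: arg_maxnP.
have : (#|X| <= size (iota i1 (i2 - i1).+1))%N.
  rewrite cardE -(size_map val); apply: uniq_leq_size.
    by rewrite map_inj_uniq ?enum_uniq//; exact: val_inj.
  move=> _ /mapP[i + ->]; rewrite mem_enum => iX.
  by rewrite mem_iota i1min//= addnS ltnS subnKC ?i2max ?i1min.
rewrite size_iota -(ler_nat R) => /le_trans; apply.
by rewrite -natr1 natrB ?i1min// lerD2r Xb.
Qed.

Lemma outer_measure_finite_cover (R : realType) (T : Type)
    (mu : {outer_measure set T -> \bar R}) (J : finType) (P : {set J})
    (A : J -> set T) (X : set T) (m : R) :
  (forall x, X x -> exists2 j, j \in P & A j x) ->
  (forall j, (mu (A j) <= m%:E)%E) -> (mu X <= (#|P|%:R * m)%:E)%E.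
Proof.
move=> XA Am; apply: (@le_trans _ _ (mu (\big[setU/set0]_(j in P) A j))).
  apply: le_outer_measure => x /XA[j jP Ajx].
  by rewrite (bigD1 j) //=; left.
apply: (@le_trans _ _ (\sum_(j in P) m%:E)%E).
  elim/big_ind2 : _ => [|B x C y Bx Cy|j _]; rewrite ?outer_measure0//.
  exact: le_trans (outer_measureU2 _ _ _) (leeD Bx Cy).
by rewrite sumEFin sumr_const mulr_natl.
Qed.

(** The double count is applied to the sets [A j] that meet one or the other of
    the two separated portions of the segment number [i]: content forces many
    of them, and a given pair of sets pins down the slope. The intervals of
    length [1 / n] tell the slopes apart. *)
Lemma count_directions (R : realType) (mu : {outer_measure set (R * R) -> \bar R})
    (J : finType) (A : J -> set (R * R)) (G : set (R * R)) (d c r m : R) (n : nat)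
    (X : {set 'I_n}) (t : 'I_n -> R) (a : 'I_n -> R * R) (len : 'I_n -> R) :
  0 <= d -> 0 < c -> 0 < r -> 0 < m ->
  (forall p, G p -> exists j, A j p) ->
  (forall j p q, A j p -> A j q -> enorm (p - q) <= d) ->
  (forall j, (mu (A j) <= m%:E)%E) ->
  (forall Y : set (R * R),
    (forall p q, Y p -> Y q -> enorm (p - q) <= r) -> (mu Y <= (c / 9)%:E)%E) ->
  (forall i, i \in X -> [/\ 0 <= t i, t i <= 1 &
     (i : nat)%:R <= n%:R * t i < (i : nat).+1%:R]) ->
  (forall i, i \in X ->
     (c%:E < mu (segment (a i) (slope_dir (t i)) (len i) `&` G))%E) ->
  #|X|%:R * (c / (3 * m)) ^+ 2 <= #|J|%:R ^+ 2 * (8 * d / r * n%:R + 2).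
Proof.
move=> d0 c0 r0 m0 GA Ad Am small tX big.
pose pc i (I : interval R) : set (R * R) :=
  line_point (a i) (slope_dir (t i)) @` [set` I] `&` G.
have /choice[s sP] i : exists s, i \in X ->
    ((c / 3)%:E < mu (pc i `[0%R, s]))%E /\ ((c / 3)%:E < mu (pc i `[(s + r)%R, len i]))%E.
  have [iX|_] := boolP (i \in X); last by exists 0.
  have [s sP] := split_segment (enorm_slope_dir _) c0 r0 small (big i iX).
  by exists s.
pose hit i (I : interval R) : {set J} := finset (fun j => `[< A j `&` pc i I !=set0 >]).
have hit_card i I : ((c / 3)%:E < mu (pc i I))%E -> c / (3 * m) <= #|hit i I|%:R.
  move=> cI; rewrite invfM mulrA ler_pdivrMr// -lee_fin (le_trans (ltW cI))//.
  apply: (outer_measure_finite_cover (A := A)) => // x xI.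
  have [j Ajx] := GA x xI.2; exists j => //.
  by rewrite inE; apply/asboolP; exists x.
apply: (@double_count _ _ _ _ (fun i => hit i `[0%R, s i])
    (fun i => hit i `[(s i + r)%R, len i])).
- by rewrite divr_ge0 ?mulr_ge0 ?ltW.
- by move=> i /sP[? _]; exact: hit_card.
- by move=> i /sP[_ ?]; exact: hit_card.
move=> j j'.
have -> : 8 * d / r * n%:R + 2 = (8 * d / r * n%:R + 1) + 1 by ring.
apply: card_cluster; first by rewrite addr_ge0 ?mulr_ge0 ?invr_ge0 ?(ltW r0).
move=> i i'; rewrite !inE => /and3P[iX /asboolP[p [Ajp [[u /= uI pE] _]]]].
move=> /asboolP[q [Aj'q [[v /= vI qE] _]]].
move=> /and3P[i'X /asboolP[p' [Ajp' [[u' /= u'I p'E] _]]]].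
move=> /asboolP[q' [Aj'q' [[v' /= v'I q'E] _]]].
have [t0 t1 /andP[it ti]] := tX i iX; have [t'0 t'1 /andP[it' ti']] := tX i' i'X.
have : `|t i - t i'| <= 8 * d / r.
  apply: (@slope_dist _ _ _ (a i) (a i') u v u' v') => //; rewrite ?t0 ?t'0//.
  - by move: uI vI; rewrite !in_itv /= => /andP[_ ?] /andP[? _]; lra.
  - by rewrite pE p'E; exact: (Ad j).
  - by rewrite qE q'E; exact: (Ad j').
rewrite ler_norml => /andP[_] /(ler_wpM2r (ler0n R n)).
by rewrite -natr1 in ti'; lra.
Qed.

(** * Outer Lebesgue measure of a set of slopes *)

(** The sets of slopes that occur need not be measurable. *)
Lemma lebesgue_outer (R : realType) :
  exists lambda : {outer_measure set R -> \bar R},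
    forall a b, a <= b -> lambda `[a, b[%classic = (b - a)%:E.
Proof.
exists [the {outer_measure set _ -> \bar R} of (@lebesgue_measure R)^*%mu].
move=> a b; rewrite le_eqVlt => /orP[/eqP->|ab] /=.
  by rewrite set_itvco0 subrr; exact: outer_measure0.
rewrite measurable_mu_extE; last exact: measurable_itv.
have := lebesgue_measure_itv (`[a, b[ : interval R).
by rewrite /= lte_fin ab EFinB => <-.
Qed.

(** If [M] of the [n] intervals of length [1 / n] meet [T], then [lambda T] is at
    most [M / n], which is at most its square root since [M <= n]. The square
    root makes the bound linear in [#|J|], so that it can be compared with the
    total cost of the sets and summed over the generations. *)
Lemma slopes_measure_le (R : realType) (lambda : {outer_measure set R -> \bar R})
    (mu : {outer_measure set (R * R) -> \bar R})
    (J : finType) (A : J -> set (R * R)) (G : set (R * R)) (c r m : R) (n : nat)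
    (T : set R) (a : R -> R * R) (len : R -> R) :
  (forall x y, x <= y -> lambda `[x, y[%classic = (y - x)%:E) ->
  0 < c -> 0 < r -> r <= 1 -> 0 < m -> (0 < n)%N ->
  (forall p, G p -> exists j, A j p) ->
  (forall j p q, A j p -> A j q -> enorm (p - q) <= 2 / n%:R) ->
  (forall j, (mu (A j) <= m%:E)%E) ->
  (forall Y : set (R * R),
    (forall p q, Y p -> Y q -> enorm (p - q) <= r) -> (mu Y <= (c / 9)%:E)%E) ->
  (forall t, T t -> 0 <= t < 1) ->
  (forall t, T t -> (c%:E < mu (segment (a t) (slope_dir t) (len t) `&` G))%E) ->
  (lambda T <=
    (#|J|%:R * (13 * m / (c * Num.sqrt r) * Num.sqrt (n%:R^-1)))%:E)%E.
Proof.
move=> lambdaE c0 r0 r1 m0 n0 GA Ad Am small T01 big.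
have nR0 : 0 < n%:R :> R by rewrite ltr0n.
pose cell (i : 'I_n) (t : R) : bool := (i : nat)%:R <= n%:R * t < (i : nat).+1%:R.
pose X : {set 'I_n} := finset (fun i => `[< exists2 t, T t & cell i t >]).
have /choice[t tP] i : exists t, i \in X -> T t /\ cell i t.
  have [|_] := boolP (i \in X); last by exists 0.
  by rewrite inE => /asboolP[t Tt it]; exists t.
have cellP s : T s -> exists i, cell i s.
  move=> /T01/andP[s0 s1].
  have ns0 : 0 <= n%:R * s by rewrite mulr_ge0// ltW.
  have sn : (Num.truncn (n%:R * s) < n)%N.
    rewrite -(ltr_nat R) (@le_lt_trans _ _ (n%:R * s)) ?truncn_le//.
    by rewrite -[ltRHS]mulr1 ltr_pM2l.
  by exists (Ordinal sn); rewrite /cell /= truncn_itv.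
have lambdaT : (lambda T <= (#|X|%:R * n%:R^-1)%:E)%E.
  apply: (outer_measure_finite_cover
    (A := fun i : 'I_n => `[(i : nat)%:R / n%:R, (i : nat).+1%:R / n%:R[%classic)).
    move=> s Ts; have [i is_] := cellP s Ts; exists i.
      by rewrite inE; apply/asboolP; exists s.
    move: is_; rewrite /cell /= in_itv /= ler_pdivrMr// ltr_pdivlMr//.
    by rewrite mulrC.
  move=> i; rewrite lambdaE.
    by rewrite lee_fin -mulrBl -natr1 addrAC subrr add0r mul1r.
  by rewrite ler_pM2r ?invr_gt0// ler_nat.
apply: (le_trans lambdaT); rewrite lee_fin.
have count : #|X|%:R * (c / (3 * m)) ^+ 2 <=
    #|J|%:R ^+ 2 * (8 * (2 / n%:R) / r * n%:R + 2).
  apply: (@count_directions _ mu _ A G _ _ _ _ _ _ t (a \o t) (len \o t)) => //.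
  - move=> i /tP[Tt it]; have /andP[t0 t1] := T01 _ Tt.
    by split => //; exact: ltW.
  - by move=> i /tP[Tt _]; exact: big.
have Xn : #|X|%:R / n%:R <= 1 :> R.
  by rewrite ler_pdivrMr// mul1r ler_nat -[leqRHS]card_ord max_card.
set M : R := #|X|%:R in count Xn *; set N : R := #|J|%:R in count *.
have M0 : 0 <= M by rewrite /M.
have N0 : 0 <= N by rewrite /N.
have sr0 : 0 < Num.sqrt r by rewrite sqrtr_gt0.
(* 162 = 18 * 3 ^ 2, where 18 / r bounds 16 / r + 2 since r <= 1; in the
   statement it is rounded up to 13 ^ 2. *)
have countM : M <= N ^+ 2 * (162 * m ^+ 2 / (c ^+ 2 * r)).
  have -> : N ^+ 2 * (162 * m ^+ 2 / (c ^+ 2 * r)) =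
      (N ^+ 2 * (18 / r)) / (c / (3 * m)) ^+ 2.
    by field; rewrite !gt_eqF.
  rewrite ler_pdivlMr ?exprn_gt0 ?divr_gt0 ?mulr_gt0//.
  apply: (le_trans count); rewrite ler_wpM2l ?sqr_ge0//.
  have -> : 8 * (2 / n%:R) / r * n%:R = 16 / r by field; rewrite !gt_eqF.
  have : 1 <= r^-1 by rewrite invf_ge1.
  lra.
have K0 : 0 < 13 * m / (c * Num.sqrt r) * Num.sqrt (n%:R^-1).
  by rewrite !(mulr_gt0, invr_gt0, sqrtr_gt0).
rewrite -(@ler_pXn2r _ 2)// ?nnegrE; first last.
- by rewrite mulr_ge0// ltW.
- by rewrite divr_ge0.
apply: (@le_trans _ _ (M / n%:R)).
  by rewrite expr2 ler_piMr ?divr_ge0.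
rewrite !(exprMn, exprVn) !sqr_sqrtr ?(ltW r0) ?invr_ge0//.
rewrite !mulrA ler_pM2r ?invr_gt0//.
apply: (le_trans countM); rewrite -!mulrA ler_wpM2l ?sqr_ge0//.
rewrite ler_wpM2l// [leRHS]mulrA ler_wpM2r//; last by lra.
by rewrite !(mulr_ge0, invr_ge0)// ltW.
Qed.

Lemma esum_ge_card (R : realType) (T : choiceType) (J : set T) (B : {fset T})
    (g : T -> \bar R) (w : R) :
  [set` B] `<=` J -> (forall j, J j -> (w%:E <= g j)%E) ->
  ((#|` B|%:R * w)%:E <= \esum_(j in J) g j)%E.
Proof.
move=> BJ wg; apply: esum_ge; exists [set` B]; first by split.
rewrite fsbig_finite//= set_fsetK.
apply: (@le_trans _ _ (\sum_(i <- B) w%:E)%E); last first.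
  by rewrite big_seq [leRHS]big_seq; apply: lee_sum => i iB; exact/wg/BJ.
by rewrite sumEFin big_const_seq count_predT iter_addr_0 mulr_natl.
Qed.

(** Each member of [J] costs at least [w], which converts the bound on the number
    of sets into a bound by their cost; an infinite [J] has infinite cost. *)
Lemma slopes_measure_le_esum (R : realType)
    (lambda : {outer_measure set R -> \bar R})
    (mu : {outer_measure set (R * R) -> \bar R})
    (I : choiceType) (J : set I) (A : I -> set (R * R)) (c r m w : R) (n : nat)
    (g : I -> \bar R) (S : set (R * R))
    (T : set R) (a : R -> R * R) (len : R -> R) :
  (forall x y, x <= y -> lambda `[x, y[%classic = (y - x)%:E) ->
  0 < c -> 0 < r -> r <= 1 -> 0 < m -> (0 < n)%N -> 0 < w ->
  (forall j p q, J j -> A j p -> A j q -> enorm (p - q) <= 2 / n%:R) ->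
  (forall j, J j -> (mu (A j) <= m%:E)%E) ->
  (forall Y : set (R * R),
    (forall p q, Y p -> Y q -> enorm (p - q) <= r) -> (mu Y <= (c / 9)%:E)%E) ->
  (forall j, J j -> (w%:E <= g j)%E) ->
  (forall t, T t -> 0 <= t < 1) ->
  (forall t, T t -> (c%:E < mu (segment (a t) (slope_dir t) (len t) `&` S `&`
     \bigcup_(j in J) A j))%E) ->
  (lambda T <= (13 * m / (c * Num.sqrt r) * Num.sqrt (n%:R^-1) / w)%:E *
    \esum_(j in J) g j)%E.
Proof.
move=> lambdaE c0 r0 r1 m0 n0 w0 Ad Am small wg T01 big.
have K0 : 0 < 13 * m / (c * Num.sqrt r) * Num.sqrt (n%:R^-1) / w.
  by rewrite !(mulr_gt0, invr_gt0, sqrtr_gt0) ?ltr0n.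
have [Jfin|Jinf] := pselect (finite_set J); last first.
  suff -> : \esum_(j in J) g j = +oo%E by rewrite gt0_muley ?leey.
  apply/eqyP => y y0.
  have [B BJ yB] := infinite_set_fset (Num.truncn (y / w)).+1 Jinf.
  apply: le_trans (esum_ge_card BJ wg).
  rewrite lee_fin -ler_pdivrMr// (le_trans (ltW (truncnS_gt _)))//.
  by rewrite ler_nat.
have JE : [set` fset_set J] = J by exact: fset_setK.
apply: (@le_trans _ _ ((13 * m / (c * Num.sqrt r) * Num.sqrt (n%:R^-1) / w)%:E *
    (#|` fset_set J|%:R * w)%:E)%E); last first.
  by rewrite lee_pmul2l// (esum_ge_card _ wg)// JE.
have JP (j : fset_set J) : J (val j).
  have : [set` fset_set J] (val j) by exact: valP.
  by rewrite JE.
apply: (le_trans (slopes_measure_le (mu := mu) (J := fset_set J) (c := c) (r := r)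
  (m := m) (n := n) (T := T) (a := a) (len := len) (A := fun j => A (val j))
  (G := S `&` \bigcup_(j in J) A j) lambdaE c0 r0 r1 m0 n0 _ _ _ small T01 _)).
- move=> p [_ [j Jj Ajp]]; have jJ : [set` fset_set J] j by rewrite JE.
  by exists [` jJ]%fset.
- by move=> j p q; exact: Ad.
- by move=> j; exact: Am.
- by move=> t /big; rewrite setIA.
- by rewrite -EFinM lee_fin -cardfE mulrC [_ * w]mulrC mulrA divfK ?gt_eqF.
Qed.

(** * Dyadic generations *)

Lemma dyadic_scale (R : realType) (x : R) : 0 < x -> x < 1 ->
  exists k, 2 ^- k <= x < 2 * 2 ^- k.
Proof.
move=> x0 x1.
have ex : exists k, 2 ^- k <= x.
  exists (Num.truncn x^-1).+1.
  rewrite -[leRHS]invrK lef_pV2 ?posrE ?invr_gt0 ?exprn_gt0//.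
  rewrite (le_trans (ltW (truncnS_gt _)))// -natrX ler_nat.
  by rewrite ltnW// ltn_expl.
case: (ex_minnP ex) => k kx kmin; exists k; rewrite kx /=.
case: k kx kmin => [|k] kx kmin; first by rewrite expr0 invr1 mulr1 (lt_trans x1) ?ltr1n.
rewrite exprS invfM mulrA divff// mul1r ltNge; apply/negP => /kmin.
by rewrite ltnn.
Qed.

Lemma dyadic_scale_unique (R : realType) (x : R) (j k : nat) :
  2 ^- j <= x < 2 * 2 ^- j -> 2 ^- k <= x < 2 * 2 ^- k -> j = k.
Proof.
wlog jk : j k / (j <= k)%N.
  by move=> H xj xk; case/orP: (leq_total j k) => /H; [exact|move/(_ xk xj)].
move=> /andP[jx _] /andP[_ xk]; apply/eqP; rewrite eqn_leq jk leqNgt.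
apply/negP => jltk; have := le_lt_trans jx xk; apply/negP; rewrite -leNgt.
case: k jltk {jk xk} => // k; rewrite ltnS => jk.
rewrite exprS invfM mulrA divff// mul1r lef_pV2 ?posrE ?exprn_gt0//.
by rewrite ler_eXn2l// ltr1n.
Qed.

Lemma outer_measure_bigcup_null (R : realType) (T : Type)
    (mu : {outer_measure set T -> \bar R}) (J : set nat) (A : nat -> set T) :
  (forall i, J i -> (mu (A i) <= 0)%E) -> (mu (\bigcup_(i in J) A i) <= 0)%E.
Proof.
move=> A0; rewrite bigcup_mkcond.
apply: (le_trans (outer_measure_sigma_subadditive mu _)).
rewrite eseries0// => i _ _; case: ifPn => [|_]; last exact: outer_measure0.
by rewrite inE => /A0 Ai; apply/eqP; rewrite eq_le Ai outer_measure_ge0.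
Qed.

(** This is where the exponent comes from: with [x] = a / [A0], the denominator
    contains [x ^ (1 + 1 / (2 alpha))], and 1 + 1 / (2 alpha) is the inverse of
    2 alpha / (2 alpha + 1), so that the power equals [F / H] up to a factor
    depending only on [A0]. Everything that varies with the scale cancels. *)
Lemma scale_constant (R : realType) (alpha c rho A0 D F H s : R) :
  0 < alpha -> 0 < c -> 0 < rho -> 0 < A0 -> 0 < F -> 0 < H -> 0 < s ->
  let x := (F / H) `^ (2 * alpha / (2 * alpha + 1)) / A0 in
  13 * (D * F) / (c * x * Num.sqrt (rho * x `^ alpha^-1)) * s / (H * s) =
  13 * D * A0 `^ (1 + (2 * alpha)^-1) / (c * Num.sqrt rho).
Proof.
move=> al0 c0 rho0 A00 F0 H0 s0 x.
have x0 : 0 < x by rewrite divr_gt0// powR_gt0// divr_gt0.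
have sq : Num.sqrt (x `^ alpha^-1) = x `^ (2 * alpha)^-1.
  by rewrite -powR12_sqrt ?powR_ge0// -powRrM invfM mulrC.
have xg : x * x `^ (2 * alpha)^-1 = x `^ (1 + (2 * alpha)^-1).
  by rewrite powRD ?powRr1 ?(ltW x0)// [x == 0]gt_eqF// implybT.
have xgE : x `^ (1 + (2 * alpha)^-1) = (F / H) / A0 `^ (1 + (2 * alpha)^-1).
  rewrite powRM ?powR_ge0 ?invr_ge0 ?(ltW A00)// -powRrM.
  have -> : 2 * alpha / (2 * alpha + 1) * (1 + (2 * alpha)^-1) = 1.
    by field; rewrite !gt_eqF//; lra.
  rewrite powRr1 ?divr_ge0 ?(ltW F0) ?(ltW H0)//; congr (_ * _).
  by rewrite -powR_inv1 ?(ltW A00)// -powRrM mulN1r powRN.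
rewrite sqrtrM ?(ltW rho0)// sq.
have -> : c * x * (Num.sqrt rho * x `^ (2 * alpha)^-1) =
    c * Num.sqrt rho * (F / H / A0 `^ (1 + (2 * alpha)^-1)).
  by rewrite -xgE -xg; ring.
have Ag0 : 0 < A0 `^ (1 + (2 * alpha)^-1) by rewrite powR_gt0.
have sr0 : 0 < Num.sqrt rho by rewrite sqrtr_gt0.
by field; rewrite !gt_eqF.
Qed.

Lemma hausdorff_content_le0 (R : realType) (h : R -> R) (delta : R) E :
  0 < delta -> (hausdorff_measure h E <= 0)%E -> (hausdorff_content h delta E <= 0)%E.
Proof.
by move=> d0; apply: le_trans; apply: ereal_sup_ubound; exists delta.
Qed.

(** * Slopes of the segments rich in points of E *)

Lemma small_radius (R : realType) (alpha C c delta : R) :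
  0 < alpha -> 0 < C -> 0 < c -> 0 < delta ->
  exists rho, [/\ 0 < rho, rho <= 1, rho < delta & C * rho `^ alpha <= c / 9].
Proof.
move=> al0 C0 c0 de0.
pose y := (c / (9 * C)) `^ alpha^-1.
have y0 : 0 < y by rewrite powR_gt0// divr_gt0// mulr_gt0.
exists (Num.min (Num.min (delta / 2) 1) y); split.
- by rewrite !lt_min y0 divr_gt0//= ltr01.
- by rewrite !ge_min lexx orbT.
- by rewrite !gt_min; apply/orP; left; apply/orP; left; lra.
- have : Num.min (Num.min (delta / 2) 1) y `^ alpha <= y `^ alpha.
    apply: ge0_ler_powR; rewrite ?nnegrE ?(ltW al0) ?(ltW y0)//.
      by rewrite !le_min (ltW y0) divr_ge0 ?(ltW de0)//= ler01.
    by rewrite ge_min lexx orbT.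
  rewrite -powRrM mulVf ?gt_eqF// powRr1; last by rewrite divr_ge0 ?mulr_ge0 ?ltW.
  move=> /(ler_wpM2l (ltW C0)) /le_trans; apply.
  by rewrite invfM mulrA mulrC mulrA mulfVK ?gt_eqF// mulrC.
Qed.

(** Given [e > 0], a cover of [E] of cost less than [e / K] is sorted into
    generations [J k], and the slopes accordingly into sets [T k] with
    [lambda (T k)] at most [K] times the cost of [J k]. *)
Lemma slopes_null (R : realType) (lambda : {outer_measure set R -> \bar R})
    (hF h : R -> R) (alpha CD C A0 delta c : R) (E : set (R * R))
    (a : R -> R * R) (len : R -> R) :
  (forall x y, x <= y -> lambda `[x, y[%classic = (y - x)%:E) ->
  dimension_function hF -> 0 < CD -> (forall x, 0 <= x -> hF (2 * x) <= CD * hF x) ->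
  0 < alpha -> 0 < C -> (forall x, 0 <= x -> hF x <= C * x `^ alpha) ->
  dimension_function h -> (forall x, 0 < x -> 0 < h x) ->
  0 < A0 ->
  (\sum_(k <oo) ((hF (2 ^- k) / h (2 ^- k))
      `^ (2 * alpha / (2 * alpha + 1)))%:E <= A0%:E)%E ->
  (hausdorff_measure (mul_sqrt h) E <= 0)%E ->
  0 < delta -> 0 < c ->
  (lambda [set t : R | (0 <= t < 1)%R /\ (c%:E <
     hausdorff_content hF delta (segment (a t) (slope_dir t) (len t) `&` E))%E]
   <= 0)%E.
Proof.
move=> lambdaE hFdim CD0 hFD al0 C0 hFC hdim h_gt0 A00 sumA HE0 de0 c0.
set S := (X in lambda X).
have [mu muE] := hausdorff_content_outer_measure hFdim de0.
have mu_le (d : R) (X : set (R * R)) : 0 <= d -> d < delta ->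
    (forall p q, X p -> X q -> enorm (p - q) <= d) -> (mu X <= (hF d)%:E)%E.
  by rewrite -muE; exact: hausdorff_content_le.
have hF0 x : 0 <= x -> 0 <= hF x by exact: dimension_function_ge0.
have hFnd x y : 0 <= x -> x <= y -> hF x <= hF y by exact: dimension_function_nd.
have p0 k : 0 < 2 ^- k :> R by rewrite invr_gt0 exprn_gt0.
pose ak k := (hF (2 ^- k) / h (2 ^- k)) `^ (2 * alpha / (2 * alpha + 1)).
have ak0 k : 0 <= ak k by exact: powR_ge0.
have akA k : ak k <= A0.
  rewrite -lee_fin (le_trans _ sumA)//.
  apply: le_trans (nneseries_lim_ge k.+1 _); last by move=> n _ _; rewrite lee_fin ak0.
  rewrite big_nat_recr//= leeDr// sume_ge0// => n _.
  by rewrite lee_fin ak0.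
pose x k := ak k / A0.
have x0 k : 0 <= x k by rewrite divr_ge0// ltW.
have x1 k : x k <= 1 by rewrite ler_pdivrMr// mul1r.
have [rho [rho0 rho1 rhod rhoc]] := small_radius al0 C0 c0 de0.
pose K := 13 * CD * A0 `^ (1 + (2 * alpha)^-1) / (c * Num.sqrt rho).
have K0 : 0 < K.
  by rewrite /K !(mulr_gt0, invr_gt0, powR_gt0, sqrtr_gt0).
apply/lee_addgt0Pr => e e0; rewrite add0e.
have eK0 : 0 < e / K by rewrite divr_gt0.
(* Diameters below 1 make the generations start at a nonnegative index, and
   those below delta let the same sets compete in the content of hF. *)
pose delta' := Num.min delta 1.
have de'0 : 0 < delta' by rewrite lt_min de0 ltr01.
have : (hausdorff_content (mul_sqrt h) delta' E < (e / K)%:E)%E.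
  by apply: (le_lt_trans (hausdorff_content_le0 de'0 HE0)); rewrite lte_fin.
move=> /ereal_inf_lt[_ [A [EA dA] <-] sumg].
pose D i := fine (ediam (A i)).
have DE i : ediam (A i) = (D i)%:E.
  by rewrite /D fineK// ge0_fin_numE ?ediam_ge0// (lt_trans (dA i))// ltry.
have D0 i : 0 <= D i by rewrite fine_ge0// ediam_ge0.
have Dd i : D i < delta.
  by rewrite -lte_fin -DE (lt_le_trans (dA i))// lee_fin ge_min lexx.
have D1 i : D i < 1.
  by rewrite -lte_fin -DE (lt_le_trans (dA i))// lee_fin ge_min lexx orbT.
have AD i p q : A i p -> A i q -> enorm (p - q) <= D i.
  by move=> Ap Aq; rewrite -lee_fin -DE enorm_le_ediam.
have muA i : (mu (A i) <= (hF (D i))%:E)%E by apply: mu_le => //; exact: AD.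
pose g i : \bar R := (mul_sqrt h (D i))%:E.
have g0 i : (0 <= g i)%E.
  by rewrite lee_fin mulr_ge0 ?sqrtr_ge0// (dimension_function_ge0 hdim).
pose J k : set nat := [set i | 2 ^- k <= D i < 2 * 2 ^- k].
have trivJ : trivIset setT J.
  by move=> j k _ _ [i [/= ij ik]]; exact: dyadic_scale_unique ij ik.
(* Doubling compares the value of hF at diameters of generation k with the one
   at 2^-k, up to a constant independent of k. *)
have muAJ k i : J k i -> (mu (A i) <= (CD * hF (2 ^- k))%:E)%E.
  move=> /andP[_ Dk]; apply: (le_trans (muA i)); rewrite lee_fin.
  by apply: le_trans (hFD _ (ltW (p0 k))); apply: hFnd => //; exact: ltW.
pose seg t := segment (a t) (slope_dir t) (len t).
pose T k := [set t | S t /\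
  ((c * x k)%:E < mu (seg t `&` E `&` \bigcup_(i in J k) A i))%E].
have T01 k t : T k t -> 0 <= t < 1 by case=> -[].
have ST : S `<=` \bigcup_k T k.
  move=> t St; apply: contrapT => nT.
  have {}nT k : (mu (seg t `&` E `&` \bigcup_(i in J k) A i) <= (c * x k)%:E)%E.
    by by rewrite leNgt; apply/negP => tk; apply: nT; exists k.
  case: (St) => _; apply/negP; rewrite -leNgt muE.
  (* Sets of diameter 0 belong to no generation, but hF 0 = 0. *)
  pose Z := \bigcup_(i in [set i | D i = 0]) A i.
  have muZ : (mu Z <= 0)%E.
    apply: outer_measure_bigcup_null => i /= Di; apply: (le_trans (muA i)).
    by rewrite Di (dimension_function0 hFdim).
  have cover : seg t `&` E `<=`
      Z `|` \bigcup_k (seg t `&` E `&` \bigcup_(i in J k) A i).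
    move=> p [segp Ep]; have [i _ Ap] := EA p Ep.
    have := D0 i; rewrite le_eqVlt => /orP[/eqP Di|Di].
      by left; exists i.
    have [k kD] := dyadic_scale Di (D1 i).
    by right; exists k => //; split => //; exists i.
  apply: (le_trans (le_outer_measure mu _ _ cover)).
  apply: (le_trans (outer_measureU2 _ _ _)).
  apply: (le_trans (leeD muZ (outer_measure_sigma_subadditive mu _))).
  rewrite add0e.
  apply: (@le_trans _ _ (\sum_(k <oo) ((c / A0)%:E * (ak k)%:E))%E).
    apply: lee_nneseries => [k _ _|k _]; first exact: outer_measure_ge0.
    by apply: (le_trans (nT k)); rewrite -EFinM lee_fin /x mulrCA mulrC mulrAC.
  rewrite nneseriesZl; last by move=> k _; rewrite lee_fin.
  apply: (le_trans (lee_wpmul2l _ sumA)); first by rewrite lee_fin divr_ge0 ?ltW.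
  by rewrite -EFinM lee_fin divfK ?gt_eqF.
have lambdaT k : (lambda (T k) <= K%:E * \esum_(i in J k) g i)%E.
  have := hF0 _ (ltW (p0 k)); rewrite le_eqVlt => /orP[/eqP F0|F0].
    (* No content can be captured when hF vanishes at scale k. *)
    suff -> : T k = set0.
      by rewrite outer_measure0 mule_ge0// ?lee_fin ?(ltW K0)// esum_ge0.
    apply/seteqP; split => // t [_]; apply/negP; rewrite -leNgt.
    rewrite /x /ak -F0 mul0r powR0 ?mul0r ?mulr0; last first.
      by rewrite gt_eqF// divr_gt0 ?addr_gt0 ?mulr_gt0.
    apply: (@le_trans _ _ (mu (\bigcup_(i in J k) A i))).
      by apply: le_outer_measure => p [].
    apply: outer_measure_bigcup_null => i Ji; apply: (le_trans (muAJ _ _ Ji)).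
    by rewrite -F0 mulr0.
  have H0 := h_gt0 _ (p0 k).
  have xk0 : 0 < x k by rewrite divr_gt0// powR_gt0// divr_gt0.
  have s0 : 0 < Num.sqrt (2 ^- k : R) by rewrite sqrtr_gt0.
  pose r := rho * x k `^ alpha^-1.
  have r0 : 0 < r by rewrite mulr_gt0// powR_gt0.
  have rrho : r <= rho.
    have : x k `^ alpha^-1 <= 1 `^ alpha^-1.
      by apply: ge0_ler_powR; rewrite ?nnegrE ?invr_ge0 ?(ltW al0).
    by rewrite powR1 => /(ler_wpM2l (ltW rho0)); rewrite mulr1.
  have -> : K = 13 * (CD * hF (2 ^- k)) / (c * x k * Num.sqrt r)
      * Num.sqrt ((2 ^ k)%N%:R^-1) / (h (2 ^- k) * Num.sqrt (2 ^- k)).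
    by rewrite natrX /r scale_constant.
  apply: (@slopes_measure_le_esum _ _ mu _ _ A _ _ _ _ _ _ E _ a len) => //.
  - by rewrite mulr_gt0.
  - exact: le_trans rrho rho1.
  - by rewrite mulr_gt0.
  - by rewrite expn_gt0.
  - by rewrite mulr_gt0.
  - move=> i p q /andP[_ Dk] Ap Aq; apply: (le_trans (AD i p q Ap Aq)).
    by rewrite natrX ltW.
  - exact: muAJ.
  - move=> Y Yr; apply: (le_trans (mu_le _ _ (ltW r0) (le_lt_trans rrho rhod) Yr)).
    rewrite lee_fin (le_trans (hFC _ (ltW r0)))//.
    rewrite powRM ?powR_ge0 ?(ltW rho0)// -powRrM mulVf ?gt_eqF// powRr1//.
    by rewrite mulrA [leRHS]mulrAC ler_wpM2r.
  - move=> i /andP[Dk _]; rewrite lee_fin ler_pM ?(ltW H0) ?(ltW s0)//.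
      by apply: (dimension_function_nd hdim) => //; exact: ltW.
    exact: ler_wsqrtr.
  - exact: T01.
  - by move=> t [].
apply: (le_trans (le_outer_measure lambda _ _ ST)).
apply: (le_trans (outer_measure_sigma_subadditive lambda _)).
apply: (@le_trans _ _ (\sum_(k <oo) (K%:E * \esum_(i in J k) g i))%E).
  by apply: lee_nneseries => k *; [exact: outer_measure_ge0|exact: lambdaT].
rewrite nneseriesZl; last by move=> k _; exact: esum_ge0.
rewrite -nneseries_sum_bigcup//.
have sub : (\esum_(i in \bigcup_k J k) g i <= \sum_(i <oo) g i)%E.
  rewrite nneseries_esumT// esum_mkcond; apply: le_esum => i _.
  by case: ifP.
apply: (le_trans (lee_wpmul2l _ (le_trans sub (ltW sumg)))).
  by rewrite lee_fin ltW.
by rewrite -EFinM lee_fin mulrC divfK ?gt_eqF.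
Qed.

Theorem theorem4p4 (R : realType) (hF h : R -> R) (alpha : R)
    (E : set (R * R)) :
  doubling_dimension_function hF ->
  0 < alpha -> alpha < 1 ->
  (exists2 C : R, 0 < C & forall x, 0 <= x -> hF x <= C * x `^ alpha) ->
  furstenberg_set hF E ->
  dimension_function h ->
  prec h hF ->
  (\sum_(k <oo) ((hF (2 ^- k) / h (2 ^- k))
      `^ (2 * alpha / (2 * alpha + 1)))%:E < +oo)%E ->
  (0 < hausdorff_measure (mul_sqrt h) E)%E.
Proof.
move=> [hFdim [CD CD0 hFD]] al0 _ [C C0 hFC] FE hdim [h_gt0 _] sum_lty.
rewrite ltNge; apply/negP => HE0.
have [A0 A00 sumA] : exists2 A0 : R, 0 < A0 &
    (\sum_(k <oo) ((hF (2 ^- k) / h (2 ^- k))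
      `^ (2 * alpha / (2 * alpha + 1)))%:E <= A0%:E)%E.
  set s := (X in (X < +oo)%E) in sum_lty *.
  have s0 : (0 <= s)%E by apply: nneseries_ge0 => k _ _; rewrite lee_fin powR_ge0.
  exists (fine s + 1); first by rewrite ltr_wpDl// fine_ge0.
  by rewrite EFinD fineK ?ge0_fin_numE// leeDl.
have [lambda lambdaE] := lebesgue_outer R.
have /choice[al alP] (t : R) : exists al : (R * R) * R,
    (0 < hausdorff_measure hF (segment al.1 (slope_dir t) al.2 `&` E))%E.
  by have [a [len [_ aE]]] := FE _ (enorm_slope_dir t); exists (a, len).
pose seg t := segment (al t).1 (slope_dir t) (al t).2.
pose S (n : nat) := [set t : R | 0 <= t < 1 /\
  ((n.+1%:R^-1)%:E < hausdorff_content hF n.+1%:R^-1 (seg t `&` E))%E].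
have cover : `[0, 1[%classic `<=` \bigcup_n S n.
  move=> t /=; rewrite in_itv /= => t01.
  have /ereal_sup_gt[_ [delta /= de0 <-] cpos] := alP t.
  have [y y0 yc] : exists2 y : R, 0 < y &
      (y%:E < hausdorff_content hF delta (seg t `&` E))%E.
    case: (hausdorff_content _ _ _) cpos => [r|_|//]; last by exists 1; rewrite ?ltry.
    by rewrite lte_fin => r0; exists (r / 2); rewrite ?lte_fin; lra.
  have m0 : 0 < Num.min y delta by rewrite lt_min y0.
  exists (Num.truncn (Num.min y delta)^-1) => //.
  set n := Num.truncn _.
  have : n.+1%:R^-1 <= Num.min y delta.
    by rewrite -[leRHS]invrK lef_pV2 ?posrE ?invr_gt0 ?ltr0n// ltW// truncnS_gt.
  rewrite le_min => /andP[ny nd]; split => //.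
  rewrite (@le_lt_trans _ _ y%:E) ?lee_fin// (lt_le_trans yc)//.
  exact: hausdorff_content_antitone.
have : (lambda `[0%R, 1%R[%classic <= 0)%E.
  apply: (le_trans (le_outer_measure lambda _ _ cover)).
  apply: (le_trans (outer_measure_sigma_subadditive lambda _)).
  rewrite eseries0// => n _ _; apply/eqP; rewrite eq_le outer_measure_ge0 andbT.
  by apply: (slopes_null (fun t => (al t).1) (fun t => (al t).2) lambdaE
    hFdim CD0 hFD al0 C0 hFC hdim h_gt0 A00 sumA HE0); rewrite invr_gt0.
by rewrite lambdaE// subr0 lee_fin ler10.
Qed.
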